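(* Let $K$ be a metric octahedral complex that is isometrically realizable in $\mathbb{R}^3$ as a nontrivially flexible octahedron. If at least two equators of $K$ belong to class $\mathrm{I}$, then all three equators of $K$ are metrically symmetric.
   Context: Octahedral complex: $K$ is the simplicial complex combinatorially equivalent to the regular octahedron, with vertices $v_1,\dots,v_6$, every two vertices being joined by an edge except the pairs $\{v_1,v_6\}$, $\{v_2,v_4\}$, $\{v_3,v_5\}$, and with the eight triangular faces $v_1v_2v_3$, $v_1v_3v_4$, $v_1v_4v_5$, $v_1v_5v_2$, $v_6v_2v_3$, $v_6v_3v_4$, $v_6v_4v_5$, $v_6v_5v_2$. Its edges carry strictly positive lengths satisfying the strict triangle inequalities on every face. The three diagonals are $v_2v_4$, $v_3v_5$, $v_1v_6$. Flexibility: an isometric realization of $K$ in $\mathbb{R}^3$ is an assignment of points to the vertices such that the endpoints of every edge are at distance equal to the length of that edge. A nontrivial flex is a continuous family $P_t$ ($t$ in a nondegenerate interval) of isometric realizations along which all three diagonals change with $t$ (no diagonal length is constant on any nondegenerate subinterval). $K$ is realizable as a nontrivially flexible octahedron if it admits a nontrivial flex. Equators: the three equators are the 4-cycles of edges $v_2v_3v_4v_5$, $v_2v_1v_4v_6$, $v_5v_1v_3v_6$. An equator with edge lengths $\ell_1,\ell_2,\ell_3,\ell_4$ is metrically symmetric if ($\ell_1=\ell_3$ and $\ell_2=\ell_4$) or ($\ell_1=\ell_2$ and $\ell_3=\ell_4$) or ($\ell_1=\ell_4$ and $\ell_2=\ell_3$). Classes: the star $K_j$ of a vertex $v_j$ is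 called a tetrahedral angle; its boundary is an equator $w_1w_2w_3w_4$ (cyclic order). Let $\alpha_i\in(0,\pi)$ be the plane angle $\angle w_iv_jw_{i+1}$ (indices mod 4) of the corresponding face, determined by the edge lengths. - $K_j$ is of class III iff ($\alpha_1=\alpha_3$ and $\alpha_2=\alpha_4$) or ($\alpha_1=\pi-\alpha_3$ and $\alpha_2=\pi-\alpha_4$). - $K_j$ is of class II with respect to the diagonal $w_1w_3$ iff it is not of class III and [($\alpha_1=\alpha_4$ and $\alpha_2=\alpha_3$) or ($\alpha_1=\pi-\alpha_4$ and $\alpha_2=\pi-\alpha_3$)]. - $K_j$ is of class II with respect to the diagonal $w_2w_4$ iff it is not of class III and [($\alpha_1=\alpha_2$ and $\alpha_3=\alpha_4$) or ($\alpha_1=\pi-\alpha_2$ and $\alpha_3=\pi-\alpha_4$)]. - $K_j$ is of class I in all other cases. Each equator bounds exactly two tetrahedral angles; the equator belongs to class I (resp. II with respect to a given diagonal, resp. III) if both of these tetrahedral angles do. It belongs to class II if it belongs to class II with respect to one of its two diagonals. *)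

(* Defs.v *)
From mathcomp Require Import all_boot all_order all_algebra.
From mathcomp Require Import all_classical all_reals all_analysis.

Set Implicit Arguments.
Unset Strict Implicit.
Unset Printing Implicit Defensive.

Import Order.TTheory GRing.Theory Num.Theory.
Import numFieldNormedType.Exports.
Local Open Scope classical_set_scope.
Local Open Scope ring_scope.

Inductive vertex := v1 | v2 | v3 | v4 | v5 | v6.

(* The pairs {v, opposite v} are the three non-edges, i.e. the diagonals. *)
Definition opposite (v : vertex) : vertex :=
  match v with
  | v1 => v6 | v6 => v1
  | v2 => v4 | v4 => v2
  | v3 => v5 | v5 => v3
  end.

Definition edge (a b : vertex) : Prop := a <> b /\ b <> opposite a.

(* Each face is listed with one ordering of its vertices only. *)
Definition face (a b c : vertex) : bool :=
  match a, b, c with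
  | (v1 | v6), v2, v3
  | (v1 | v6), v3, v4
  | (v1 | v6), v4, v5
  | (v1 | v6), v5, v2 => true
  | _, _, _ => false
  end.

(* [l a b] is the length of the edge {a, b}; the values of [l] on pairs that
   are not edges are never used. *)
Definition metric_octahedron (R : realType) (l : vertex -> vertex -> R) : Prop :=
  [/\ forall a b, edge a b -> l a b = l b a,
      forall a b, edge a b -> 0 < l a b
    & forall a b c, face a b c ->
        [/\ l a b < l b c + l c a, l b c < l c a + l a b
          & l c a < l a b + l b c]].

(* The norm that the library puts on ['rV[R]_3] is the sup norm, hence this
   explicit Euclidean distance; both induce the same topology. *)
Definition edist (R : realType) (x y : 'rV[R]_3) : R :=
  Num.sqrt (\sum_(i < 3) (x 0 i - y 0 i) ^+ 2).

Definition isometric_realization (R : realType) (l : vertex -> vertex -> R)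
    (p : vertex -> 'rV[R]_3) : Prop :=
  forall a b, edge a b -> edist (p a) (p b) = l a b.

Definition nondegenerate_interval (R : realType) (I : set R) : Prop :=
  is_interval I /\ exists s t, [/\ I s, I t & s < t].

Definition nontrivial_flex (R : realType) (l : vertex -> vertex -> R)
    (I : set R) (P : R -> vertex -> 'rV[R]_3) : Prop :=
  [/\ nondegenerate_interval I,
      forall v, {within I, continuous (fun t => P t v)},
      forall t, I t -> isometric_realization l (P t)
    & forall (v : vertex) (J : set R),
        nondegenerate_interval J -> J `<=` I ->
        ~ exists c : R, forall t, J t -> edist (P t v) (P t (opposite v)) = c].

Definition nontrivially_flexible (R : realType)
    (l : vertex -> vertex -> R) : Prop :=
  exists (I : set R) (P : R -> vertex -> 'rV[R]_3), nontrivial_flex l I P.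

Inductive equator := eq2345 | eq2146 | eq5136.

(* The vertices of an equator, in cyclic order. *)
Definition equator_cycle (e : equator) : vertex * vertex * vertex * vertex :=
  match e with
  | eq2345 => (v2, v3, v4, v5)
  | eq2146 => (v2, v1, v4, v6)
  | eq5136 => (v5, v1, v3, v6)
  end.

(* The boundary of the star of [v]. *)
Definition star_boundary (v : vertex) : equator :=
  match v with
  | v1 | v6 => eq2345
  | v3 | v5 => eq2146
  | v2 | v4 => eq5136
  end.

Definition metrically_symmetric (R : realType) (l : vertex -> vertex -> R)
    (e : equator) : Prop :=
  let: (w1, w2, w3, w4) := equator_cycle e in
  let l1 := l w1 w2 in let l2 := l w2 w3 in
  let l3 := l w3 w4 in let l4 := l w4 w1 in
  [\/ l1 = l3 /\ l2 = l4, l1 = l2 /\ l3 = l4 | l1 = l4 /\ l2 = l3].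

(* The angle at [v] of the triangle [v a b], by the law of cosines. *)
Definition plane_angle (R : realType) (l : vertex -> vertex -> R)
    (v a b : vertex) : R :=
  acos ((l v a ^+ 2 + l v b ^+ 2 - l a b ^+ 2) / (2 * l v a * l v b)).

(* [Q] holds of the four consecutive plane angles of the star of [v]. *)
Definition star_angles (R : realType) (l : vertex -> vertex -> R) (v : vertex)
    (Q : R -> R -> R -> R -> Prop) : Prop :=
  let: (w1, w2, w3, w4) := equator_cycle (star_boundary v) in
  Q (plane_angle l v w1 w2) (plane_angle l v w2 w3)
    (plane_angle l v w3 w4) (plane_angle l v w4 w1).

Definition star_class_III (R : realType) (l : vertex -> vertex -> R)
    (v : vertex) : Prop :=
  star_angles l v (fun a1 a2 a3 a4 =>
    (a1 = a3 /\ a2 = a4) \/ (a1 = pi - a3 /\ a2 = pi - a4)).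

(* Class II with respect to the diagonal [w1 w3]. *)
Definition star_class_II13 (R : realType) (l : vertex -> vertex -> R)
    (v : vertex) : Prop :=
  ~ star_class_III l v /\
  star_angles l v (fun a1 a2 a3 a4 =>
    (a1 = a4 /\ a2 = a3) \/ (a1 = pi - a4 /\ a2 = pi - a3)).

(* Class II with respect to the diagonal [w2 w4]. *)
Definition star_class_II24 (R : realType) (l : vertex -> vertex -> R)
    (v : vertex) : Prop :=
  ~ star_class_III l v /\
  star_angles l v (fun a1 a2 a3 a4 =>
    (a1 = a2 /\ a3 = a4) \/ (a1 = pi - a2 /\ a3 = pi - a4)).

Definition star_class_I (R : realType) (l : vertex -> vertex -> R)
    (v : vertex) : Prop :=
  [/\ ~ star_class_III l v, ~ star_class_II13 l v & ~ star_class_II24 l v].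

(* Both tetrahedral angles bounded by [e] are of class I. *)
Definition equator_class_I (R : realType) (l : vertex -> vertex -> R)
    (e : equator) : Prop :=
  forall v, star_boundary v = e -> star_class_I l v.

(* Main.v *)
Require Import Defs.
From mathcomp Require Import all_boot all_order all_algebra.
From mathcomp Require Import all_classical all_reals all_analysis.
From mathcomp Require Import ring lra.

(** Let [y] and [z] be the squared diagonals of the equator [w1 w2 w3 w4], seen
    from the apex [v] of one of its two stars.  The Gram determinant of the four
    spokes vanishes, which is a relation [F_v(y, z) = 0] of degree 2 in each
    diagonal.  Its discriminant in [z] is, up to a positive factor,
    [(u - cos(a1 + a2)) (u - cos(a1 - a2)) (u - cos(a3 + a4)) (u - cos(a3 - a4))]
    with [u] affine in [y]: it is a square only in class III or class II with
    respect to [w1 w3].  Along a flex, [F_v] and [F_o] for the opposite apex [o]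
    have infinitely many common zeros, so in class I they are proportional over
    [R(y)].  A root [y] of the coefficient of [z^2] in [F_v] that is not a root
    of that of [F_o] would kill [F_v(y, -)], which means class II with respect
    to [w2 w4] (or III).  The roots being [(|v w1| +- |v w3|)^2], the pairs
    [{|v w1|, |v w3|}] and [{|o w1|, |o w3|}] coincide, and likewise for [w2, w4].
    Thus one equator of class I makes the two others metrically symmetric. *)

Set Implicit Arguments.
Unset Strict Implicit.
Unset Printing Implicit Defensive.

Import Order.TTheory GRing.Theory Num.Theory.
Import numFieldNormedType.Exports.
Local Open Scope classical_set_scope.
Local Open Scope ring_scope.

(* MathComp-Analysis also has an [edist], the extended distance. *)
Local Notation edist := Defs.edist.

(** * Common roots of two quadratics over a polynomial ring *)

Lemma poly_eq0_itv (R : realFieldType) (p : {poly R}) (a b : R) :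
  a < b -> (forall y, a < y < b -> p.[y] = 0) -> p = 0.
Proof.
move=> ab p0; apply/eqP; apply: contraT => pN0.
(* Infinitely many distinct points; the shift to [i.+2] keeps even the first one strictly below
   [b]. *)
pose f (i : nat) := a + (b - a) / i.+2%:R.
have f_inj : injective f.
  have ba : b - a != 0 by rewrite subr_eq0 gt_eqF.
  by move=> i j /addrI/(mulfI ba)/invr_inj/eqP; rewrite eqr_nat => /eqP[].
have : (size (map f (iota 0 (size p))) < size p)%N.
  apply: max_poly_roots => //; last by rewrite map_inj_uniq ?iota_uniq.
  apply/allP => _ /mapP[i _ ->]; apply/rootP/p0; rewrite /f.
  have i0 : 0 < (i.+2%:R : R) by rewrite ltr0n.
  have i1 : (i.+2%:R : R)^-1 < 1 by rewrite invf_lt1 ?ltr1n.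
  have i2 : 0 < (i.+2%:R : R)^-1 by rewrite invr_gt0.
  have ba : 0 < b - a by rewrite subr_gt0.
  by rewrite ltrDl mulr_gt0//= -ltrBrDl gtr_pMr.
by rewrite size_map size_iota ltnn.
Qed.

(** Eliminating the common root [z], which satisfies [n = - m z], and completing the square shows
    that the discriminant times [m ^+ 2] is a square. A root of odd multiplicity then forces
    [m = 0], hence [n = 0]. *)
Lemma biquadratic_proportional (R : realFieldType)
    (P Q S P' Q' S' : {poly R}) (a b r : R) :
  a < b ->
  (forall y, a < y < b -> exists z,
     P.[y] * z ^+ 2 + Q.[y] * z + S.[y] = 0 /\
     P'.[y] * z ^+ 2 + Q'.[y] * z + S'.[y] = 0) ->
  odd (mup r (Q ^+ 2 - 4 * P * S)) ->
  P' * Q = P * Q' /\ P' * S = P * S'.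
Proof.
move=> ab H oddmu.
pose m := P' * Q - P * Q'; pose n := P' * S - P * S'.
have mn y : a < y < b -> exists z,
    P.[y] * z ^+ 2 + Q.[y] * z + S.[y] = 0 /\ n.[y] = - (m.[y] * z).
  move=> /H[z [e e']]; exists z; split=> //.
  have : P'.[y] * (P.[y] * z ^+ 2 + Q.[y] * z + S.[y])
    - P.[y] * (P'.[y] * z ^+ 2 + Q'.[y] * z + S'.[y]) = 0.
    by rewrite e e' !mulr0 subrr.
  rewrite /m /n !(hornerD, hornerN, hornerM) => {}e.
  by apply/eqP; rewrite -subr_eq0 -e; apply/eqP; ring.
have T0 : P * n ^+ 2 - Q * m * n + S * m ^+ 2 = 0.
  apply: (poly_eq0_itv ab) => y /mn[z [e en]].
  have -> (f g : {poly R}) : (P * g ^+ 2 - Q * f * g + S * f ^+ 2).[y] =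
      P.[y] * g.[y] ^+ 2 - Q.[y] * f.[y] * g.[y] + S.[y] * f.[y] ^+ 2.
    by rewrite !(hornerD, hornerN, hornerM, horner_exp).
  by rewrite en -(mulr0 (m.[y] ^+ 2)) -e; ring.
have [m0|mN0] := eqVneq m 0.
  have n0 : n = 0.
    by apply: (poly_eq0_itv ab) => y /mn[z [_ ->]]; rewrite m0 hornerE; ring.
  by split; apply/eqP; rewrite -subr_eq0 ?[_ - _]m0 ?[_ - _]n0.
have D0 : Q ^+ 2 - 4 * P * S != 0.
  apply: contraTneq oddmu => ->.
  (* By convention [mup r 0] is 0: the exponent is sought among the ordinals below [(size 0).+1]. *)
  rewrite /mup; case: arg_maxnP => [|i _ _]; first by rewrite expr0 dvd1p.
  by move: (ltn_ord i); move: (nat_of_ord i) => j;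
    rewrite size_poly0 ltnS leqn0 => /eqP ->.
have sq : (Q ^+ 2 - 4 * P * S) * (m * m) =
    (2 * P * n - Q * m) * (2 * P * n - Q * m).
  apply/eqP; rewrite eq_sym -subr_eq0 -(mulr0 (4 * P)) -T0; apply/eqP; ring.
have w0 : 2 * P * n - Q * m != 0.
  have : (Q ^+ 2 - 4 * P * S) * (m * m) != 0 by rewrite !mulf_neq0.
  by rewrite sq mulf_eq0 orbb.
move/(congr1 (fun p => odd (mup r p))): sq.
by rewrite !mupM ?mulf_neq0// !oddD !addbb oddmu.
Qed.

(** * The cosine relation of a star *)

(* The Gram determinant of four unit vectors, of consecutive inner products
   [c1, c2, c3, c4] and diagonal ones [u, v], as a polynomial in [v]. *)
Definition cos_relation (R : realFieldType) (c1 c2 c3 c4 u v : R) :=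
  (u ^+ 2 - 1) * v ^+ 2 + 2 * (c2 * c3 + c1 * c4 - (c1 * c3 + c2 * c4) * u) * v
  + (2 * (c1 * c2 + c3 * c4) * u - u ^+ 2 + 1 - c1 ^+ 2 - c2 ^+ 2 - c3 ^+ 2
     - c4 ^+ 2 + (c1 * c3 - c2 * c4) ^+ 2).

(** With mixed signs the equal products vanish, so one entry is 0 and its sign can be chosen
    freely. *)
Lemma eq_pair_of_sqr (R : realDomainType) (x y z w : R) :
  x ^+ 2 = z ^+ 2 -> y ^+ 2 = w ^+ 2 -> x * y = z * w ->
  (x = z /\ y = w) \/ (x = - z /\ y = - w).
Proof.
move=> /eqP + /eqP; rewrite !eqf_sqr => /orP[]/eqP -> /orP[]/eqP -> e;
  try by [left | right].
- have /eqP : z * w = 0 by lra.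
  by rewrite mulf_eq0 => /orP[]/eqP ->; rewrite ?oppr0; [right | left].
- have /eqP : z * w = 0 by lra.
  by rewrite mulf_eq0 => /orP[]/eqP ->; rewrite ?oppr0; [left | right].
Qed.

(* [cos_poly2, cos_poly1, cos_poly0] are the coefficients, in decreasing degree
   in [z], of [k ^+ 2 * cos_relation] at [u = (s - y) / h] and [v = (t - z) / k],
   with ['X] standing for [y]. *)
Section CosPoly.
Variables (R : rcfType) (c1 c2 c3 c4 s h t k : R).

Definition diag_poly : {poly R} := (- h^-1)%:P * ('X - s%:P).
Let U := diag_poly.

Definition cos_poly2 : {poly R} := U ^+ 2 - 1.
Definition cos_poly1 : {poly R} :=
  - (2 * t%:P * cos_poly2 + (k * 2 * (c2 * c3 + c1 * c4))%:P
     - (k * 2 * (c1 * c3 + c2 * c4))%:P * U).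
Definition cos_poly0 : {poly R} :=
  (t ^+ 2)%:P * cos_poly2 + (k * t * 2 * (c2 * c3 + c1 * c4))%:P
     - (k * t * 2 * (c1 * c3 + c2 * c4))%:P * U
  + (k ^+ 2)%:P * ((2 * (c1 * c2 + c3 * c4))%:P * U - U ^+ 2
     + (1 - c1 ^+ 2 - c2 ^+ 2 - c3 ^+ 2 - c4 ^+ 2 + (c1 * c3 - c2 * c4) ^+ 2)%:P).

Lemma horner_diag_poly y : U.[y] = (s - y) / h.
Proof. by rewrite /U /diag_poly !hornerE; ring. Qed.

Lemma horner_cos_poly y z : k != 0 ->
  cos_poly2.[y] * z ^+ 2 + cos_poly1.[y] * z + cos_poly0.[y] =
  k ^+ 2 * cos_relation c1 c2 c3 c4 ((s - y) / h) ((t - z) / k).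
Proof.
move=> k0; rewrite /cos_poly1 /cos_poly0 /cos_poly2 -horner_diag_poly.
rewrite /U; generalize diag_poly => W.
rewrite !(hornerD, hornerN, hornerM, hornerC, horner_exp) /cos_relation.
by field; exact: k0.
Qed.

(** Here [x1] stands for [sin a1 * sin a2], up to sign, so [c1 * c2 + x1] and [c1 * c2 - x1] are the
    cosines of [a1 - a2] and [a1 + a2]. Each pair of factors is minus the Gram determinant of the
    first and third unit vectors with one of the other two. *)
Lemma cos_poly_discr x1 x2 :
  x1 ^+ 2 = (1 - c1 ^+ 2) * (1 - c2 ^+ 2) ->
  x2 ^+ 2 = (1 - c3 ^+ 2) * (1 - c4 ^+ 2) ->
  cos_poly1 ^+ 2 - 4 * cos_poly2 * cos_poly0 =
  (4 * k ^+ 2)%:P * ((U - (c1 * c2 + x1)%:P) * (U - (c1 * c2 - x1)%:P)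
    * (U - (c3 * c4 + x2)%:P) * (U - (c3 * c4 - x2)%:P)).
Proof.
have sqD (c x : R) : (U - (c + x)%:P) * (U - (c - x)%:P) =
  (U - c%:P) ^+ 2 - (x ^+ 2)%:P by ring.
move=> e1 e2; rewrite -[_ * _ * _ * _]mulrA !sqD e1 e2.
rewrite /cos_poly1 /cos_poly0 /cos_poly2.
ring.
Qed.

Lemma diag_poly_subC rho : h != 0 ->
  U - rho%:P = (- h^-1)%:P * ('X - (s - h * rho)%:P).
Proof.
move=> h0; rewrite /U /diag_poly.
have e : (h^-1 * h)%:P = 1 :> {poly R} by rewrite mulVf.
have -> : (- h^-1)%:P * ('X - (s - h * rho)%:P) =
  (- h^-1)%:P * ('X - s%:P) - (h^-1 * h)%:P * rho%:P :> {poly R} by ring.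
by rewrite e mul1r.
Qed.

(** The roots form two pairs [r1 < r2] and [r3 < r4]. Unless the pairs coincide, the smaller of two
    distinct left ends, or of two distinct right ends after equal left ends, is a simple root. *)
Lemma cos_poly_discr_odd : 0 < h -> 0 < k ->
  c1 ^+ 2 < 1 -> c2 ^+ 2 < 1 -> c3 ^+ 2 < 1 -> c4 ^+ 2 < 1 ->
  ~ ((c1 = c3 /\ c2 = c4) \/ (c1 = - c3 /\ c2 = - c4)) ->
  ~ ((c1 = c4 /\ c2 = c3) \/ (c1 = - c4 /\ c2 = - c3)) ->
  exists r, odd (mup r (cos_poly1 ^+ 2 - 4 * cos_poly2 * cos_poly0)).
Proof.
move=> h0 k0 c1l c2l c3l c4l N3 N13.
pose x1 := Num.sqrt ((1 - c1 ^+ 2) * (1 - c2 ^+ 2)).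
pose x2 := Num.sqrt ((1 - c3 ^+ 2) * (1 - c4 ^+ 2)).
have x1p : 0 < x1 by rewrite sqrtr_gt0 mulr_gt0 ?subr_gt0.
have x2p : 0 < x2 by rewrite sqrtr_gt0 mulr_gt0 ?subr_gt0.
have e1 : x1 ^+ 2 = (1 - c1 ^+ 2) * (1 - c2 ^+ 2).
  by rewrite sqr_sqrtr// mulr_ge0// subr_ge0 ltW.
have e2 : x2 ^+ 2 = (1 - c3 ^+ 2) * (1 - c4 ^+ 2).
  by rewrite sqr_sqrtr// mulr_ge0// subr_ge0 ltW.
rewrite (cos_poly_discr e1 e2) !diag_poly_subC ?gt_eqF//.
set r1 := s - _; set r2 := s - _; set r3 := s - _; set r4 := s - _.
have r12 : r1 < r2 by rewrite /r1 /r2; nra.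
have r34 : r3 < r4 by rewrite /r3 /r4; nra.
have muE r : mup r ((4 * k ^+ 2)%:P * ((- h^-1)%:P * ('X - r1%:P) *
    ((- h^-1)%:P * ('X - r2%:P)) * ((- h^-1)%:P * ('X - r3%:P)) *
    ((- h^-1)%:P * ('X - r4%:P)))) = count_mem r [:: r1; r2; r3; r4].
  rewrite -mu_prod_XsubC !big_cons big_nil.
  have -> : (4 * k ^+ 2)%:P * ((- h^-1)%:P * ('X - r1%:P) *
    ((- h^-1)%:P * ('X - r2%:P)) * ((- h^-1)%:P * ('X - r3%:P)) *
    ((- h^-1)%:P * ('X - r4%:P))) = (4 * k ^+ 2 * h^-1 ^+ 4)%:P * (('X - r1%:P) *
    (('X - r2%:P) * (('X - r3%:P) * (('X - r4%:P) * 1)))) :> {poly R} by ring.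
  by rewrite mupMr// rootC gt_eqF// !mulr_gt0 ?exprn_gt0 ?invr_gt0.
have [r13|r13|r13] := ltgtP r1 r3.
- exists r1; rewrite muE /= eqxx; rewrite !gt_eqF //; lra.
- exists r3; rewrite muE /= eqxx; rewrite !gt_eqF //; lra.
have [r24|r24|r24] := ltgtP r2 r4.
- have [n1 n3 n4] : [/\ r1 != r2, r3 != r2 & r4 != r2].
    by split; [rewrite lt_eqF | rewrite -r13 lt_eqF | rewrite gt_eqF].
  by exists r2; rewrite muE /= eqxx (negPf n1) (negPf n3) (negPf n4).
- have [n1 n2 n3] : [/\ r1 != r4, r2 != r4 & r3 != r4].
    by split; [rewrite r13 lt_eqF | rewrite gt_eqF | rewrite lt_eqF].
  by exists r4; rewrite muE /= eqxx (negPf n1) (negPf n2) (negPf n3).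
exfalso.
have hinj x y : s - h * x = s - h * y -> x = y.
  by move=> /addrI/oppr_inj/mulfI; apply; rewrite gt_eqF.
move/hinj: r13 => r13; move/hinj: r24 => r24.
have p12 : c1 * c2 = c3 * c4 by lra.
have x12 : x1 = x2 by lra.
rewrite x12 e2 in e1.
have q : c1 ^+ 2 + c2 ^+ 2 = c3 ^+ 2 + c4 ^+ 2.
  by have := congr1 (fun x => x ^+ 2) p12; lra.
(* Equal sums and products of squares make [c1 ^+ 2] a root of the quadratic with roots [c3 ^+ 2]
   and [c4 ^+ 2]. *)
have /eqP : (c1 ^+ 2 - c3 ^+ 2) * (c1 ^+ 2 - c4 ^+ 2) = 0.
  transitivity (c1 ^+ 2 * (c1 ^+ 2 + c2 ^+ 2 - (c3 ^+ 2 + c4 ^+ 2))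
     + (c3 * c4) ^+ 2 - (c1 * c2) ^+ 2); [ring | rewrite p12 q; ring].
rewrite mulf_eq0 !subr_eq0 => /orP[] /eqP e.
  apply: N3; apply: eq_pair_of_sqr => //; lra.
by apply: N13; apply: eq_pair_of_sqr => //; lra.
Qed.

End CosPoly.

(** At [u = e] the relation is affine in [v], with slope [- 2 * e * d * f]. So [d] or [f] vanishes,
    and the constant term then kills the other one. *)
Lemma cos_relation_degenerate (R : realFieldType) (c1 c2 c3 c4 e : R) :
  c2 ^+ 2 < 1 -> c4 ^+ 2 < 1 -> e ^+ 2 = 1 ->
  (forall v, cos_relation c1 c2 c3 c4 e v = 0) -> c1 = e * c2 /\ c3 = e * c4.
Proof.
move=> c2l c4l e2 H; pose d := c1 - e * c2; pose f := c3 - e * c4.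
have relE v : cos_relation c1 c2 c3 c4 e v =
    - (2 * e * d * f * v) - d ^+ 2 - f ^+ 2 + (c1 * c3 - c2 * c4) ^+ 2.
  by rewrite /cos_relation /d /f; ring: e2.
have := H 0; have := H 1; rewrite !relE => H1 H0.
have /eqP : e * (d * f) = 0 by lra.
have e0 : e != 0 by apply: contra_eq_neq e2 => ->; rewrite expr0n eq_sym oner_eq0.
rewrite mulf_eq0 (negPf e0) mulf_eq0 /= => /orP[]/eqP d0.
- have c1E : c1 = e * c2 by apply/eqP; rewrite -subr_eq0 -/d d0.
  have /eqP : f ^+ 2 * (1 - c2 ^+ 2) = 0.
    have -> : f ^+ 2 * (1 - c2 ^+ 2) = f ^+ 2 - (c1 * c3 - c2 * c4) ^+ 2.
      by rewrite c1E /f; ring: e2.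
    by move: H0; rewrite d0; lra.
  by rewrite mulf_eq0 expf_eq0 /= [X in _ || X]subr_eq0
    (gt_eqF c2l) orbF subr_eq0 => /eqP.
- have c3E : c3 = e * c4 by apply/eqP; rewrite -subr_eq0 -/f d0.
  have /eqP : d ^+ 2 * (1 - c4 ^+ 2) = 0.
    have -> : d ^+ 2 * (1 - c4 ^+ 2) = d ^+ 2 - (c1 * c3 - c2 * c4) ^+ 2.
      by rewrite c3E /d; ring: e2.
    by move: H0; rewrite d0; lra.
  by rewrite mulf_eq0 expf_eq0 /= [X in _ || X]subr_eq0
    (gt_eqF c4l) orbF subr_eq0 => /eqP.
Qed.

(** At the root [s - h * e] of the first leading coefficient, proportionality leaves two cases: the
    second leading coefficient vanishes too, or the first relation degenerates, contrary to the
    third exclusion. *)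
Lemma common_relation_roots (R : rcfType)
    (c1 c2 c3 c4 c1' c2' c3' c4' s h t k s' h' t' k' a b : R) :
  0 < h -> 0 < k -> 0 < h' -> 0 < k' ->
  c1 ^+ 2 < 1 -> c2 ^+ 2 < 1 -> c3 ^+ 2 < 1 -> c4 ^+ 2 < 1 ->
  ~ ((c1 = c3 /\ c2 = c4) \/ (c1 = - c3 /\ c2 = - c4)) ->
  ~ ((c1 = c4 /\ c2 = c3) \/ (c1 = - c4 /\ c2 = - c3)) ->
  ~ ((c1 = c2 /\ c3 = c4) \/ (c1 = - c2 /\ c3 = - c4)) ->
  a < b ->
  (forall y, a < y < b -> exists z,
     cos_relation c1 c2 c3 c4 ((s - y) / h) ((t - z) / k) = 0 /\
     cos_relation c1' c2' c3' c4' ((s' - y) / h') ((t' - z) / k') = 0) ->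
  forall e, e ^+ 2 = 1 -> (s' - (s - h * e)) ^+ 2 = h' ^+ 2.
Proof.
move=> h0 k0 h'0 k'0 c1l c2l c3l c4l N3 N13 N24 ab H e e2.
have [r odd_r] := cos_poly_discr_odd s t h0 k0 c1l c2l c3l c4l N3 N13.
have [] := biquadratic_proportional (P' := cos_poly2 s' h')
    (Q' := cos_poly1 c1' c2' c3' c4' s' h' t' k')
    (S' := cos_poly0 c1' c2' c3' c4' s' h' t' k') ab _ odd_r.
  move=> y /H[z [rel rel']]; exists z.
  by rewrite !horner_cos_poly ?gt_eqF// rel rel' !mulr0.
set y0 := s - h * e.
have P0 : (cos_poly2 s h).[y0] = 0.
  rewrite /cos_poly2 hornerD hornerN hornerC horner_exp horner_diag_poly.
  by rewrite /y0 opprB addrCA subrr addr0 mulrC mulKf ?gt_eqF// e2 subrr.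
move=> /(congr1 (fun p => p.[y0])) + /(congr1 (fun p => p.[y0])).
rewrite !hornerM P0 !mul0r => /eqP + /eqP; rewrite !mulf_eq0.
have [P'0 _ _|_ /= /eqP Q0 /eqP S0] := eqVneq (cos_poly2 s' h').[y0] 0.
  move: P'0; rewrite /cos_poly2 hornerD hornerN hornerC horner_exp.
  rewrite horner_diag_poly expr_div_n => /eqP; rewrite subr_eq0 => /eqP P'0.
  by rewrite -[RHS]mul1r -P'0 divfK// expf_neq0// gt_eqF.
exfalso; apply: N24.
have [] := @cos_relation_degenerate _ c1 c2 c3 c4 e c2l c4l e2.
  (* The value [t - k * v] of [z] is the one whose cosine is [v]. *)
  move=> v; have := horner_cos_poly c1 c2 c3 c4 s h t y0 (t - k * v) (lt0r_neq0 k0).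
  have -> : (s - y0) / h = e by rewrite /y0; field; rewrite gt_eqF.
  have -> : (t - (t - k * v)) / k = v by field; rewrite gt_eqF.
  rewrite P0 Q0 S0 !mul0r !addr0 => /esym/eqP.
  by rewrite mulf_eq0 expf_eq0 /= gt_eqF// => /eqP.
by move/eqP: e2; rewrite sqrf_eq1 => /orP[]/eqP ->; rewrite ?mul1r ?mulN1r;
  [left | right].
Qed.

(** The values [e = 1] and [e = -1] put [(a1 - a3) ^+ 2] and [(a1 + a3) ^+ 2] among the same
    expressions in [b1, b3]. Positivity orders them, so they match in order; the sign of the
    difference decides between the two pairings. *)
Lemma pair_eq_of_diagonal_roots (R : rcfType) (a1 a3 b1 b3 : R) :
  0 < a1 -> 0 < a3 -> 0 < b1 -> 0 < b3 ->
  (forall e, e ^+ 2 = 1 ->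
     (b1 ^+ 2 + b3 ^+ 2 - (a1 ^+ 2 + a3 ^+ 2 - 2 * a1 * a3 * e)) ^+ 2
     = (2 * b1 * b3) ^+ 2) ->
  (a1 = b1 /\ a3 = b3) \/ (a1 = b3 /\ a3 = b1).
Proof.
move=> a1p a3p b1p b3p H.
have := H 1 (expr1n _ _); have := H (-1) (sqrr_sign _ 1).
move=> /eqP + /eqP; rewrite !eqf_sqr => M m.
have ap := mulr_gt0 a1p a3p; have bp := mulr_gt0 b1p b3p.
have {}m : (a1 - a3) ^+ 2 = (b1 - b3) ^+ 2 \/ (a1 - a3) ^+ 2 = (b1 + b3) ^+ 2.
  by case/orP: m => /eqP m; [left | right]; lra.
have {}M : (a1 + a3) ^+ 2 = (b1 - b3) ^+ 2 \/ (a1 + a3) ^+ 2 = (b1 + b3) ^+ 2.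
  by case/orP: M => /eqP M; [left | right]; lra.
have {}M : (a1 + a3) ^+ 2 = (b1 + b3) ^+ 2 by case: M m => // M [] m; nra.
have {}m : (a1 - a3) ^+ 2 = (b1 - b3) ^+ 2 by case: m => // m; nra.
move: M m => /eqP + /eqP; rewrite !eqf_sqr => /orP[]/eqP M /orP[]/eqP m;
  [left | right | |]; lra.
Qed.

(** * Gram determinants and cosines in Euclidean space *)

(** Four vectors of a 3-space are dependent. The expansion is [cos_relation] before normalising the
    vectors. *)
Lemma gram_det4_eq0 (R : comPzRingType)
    (x1 y1 z1 x2 y2 z2 x3 y3 z3 x4 y4 z4 : R) :
  let A1 := x1 * x1 + y1 * y1 + z1 * z1 in
  let A2 := x2 * x2 + y2 * y2 + z2 * z2 in
  let A3 := x3 * x3 + y3 * y3 + z3 * z3 in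
  let A4 := x4 * x4 + y4 * y4 + z4 * z4 in
  let g1 := x1 * x2 + y1 * y2 + z1 * z2 in
  let g2 := x2 * x3 + y2 * y3 + z2 * z3 in
  let g3 := x3 * x4 + y3 * y4 + z3 * z4 in
  let g4 := x4 * x1 + y4 * y1 + z4 * z1 in
  let u := x1 * x3 + y1 * y3 + z1 * z3 in
  let v := x2 * x4 + y2 * y4 + z2 * z4 in
  (u ^+ 2 - A1 * A3) * v ^+ 2
  + 2 * (A1 * g2 * g3 + A3 * g1 * g4 - (g1 * g3 + g2 * g4) * u) * v
  + (2 * (A4 * g1 * g2 + A2 * g3 * g4) * u - A2 * A4 * u ^+ 2 + A1 * A2 * A3 * A4
     - g1 ^+ 2 * A3 * A4 - g2 ^+ 2 * A1 * A4 - g3 ^+ 2 * A1 * A2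
     - g4 ^+ 2 * A2 * A3 + (g1 * g3 - g2 * g4) ^+ 2) = 0.
Proof. by cbv zeta; ring. Qed.

Definition law_cos (R : realFieldType) (a b c : R) :=
  (a ^+ 2 + b ^+ 2 - c ^+ 2) / (2 * a * b).

Lemma edist_sqr (R : realType) (x y : 'rV[R]_3) :
  edist x y ^+ 2 = (x 0 ord0 - y 0 ord0) ^+ 2 +
    ((x 0 (lift ord0 ord0) - y 0 (lift ord0 ord0)) ^+ 2
     + (x 0 (lift ord0 (lift ord0 ord0)) - y 0 (lift ord0 (lift ord0 ord0))) ^+ 2).
Proof.
rewrite sqr_sqrtr; last by apply: sumr_ge0 => i _; rewrite sqr_ge0.
by rewrite !big_ord_recl big_ord0 addr0.
Qed.

(** Spelled out in coordinates so that the sums of [gram_det4_eq0] fold into it. *)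
Definition dot_from (R : realType) (o x y : 'rV[R]_3) : R :=
  let d (z : 'rV[R]_3) i := z 0 i - o 0 i in
  d x ord0 * d y ord0 + d x (lift ord0 ord0) * d y (lift ord0 ord0)
  + d x (lift ord0 (lift ord0 ord0)) * d y (lift ord0 (lift ord0 ord0)).

Lemma dot_fromxx (R : realType) (o x : 'rV[R]_3) :
  dot_from o x x = edist o x ^+ 2.
Proof. by rewrite edist_sqr /dot_from; ring. Qed.

Lemma law_cos_edist (R : realType) (o x y : 'rV[R]_3) (a b : R) :
  0 < a -> 0 < b -> edist o x = a -> edist o y = b ->
  law_cos a b (edist x y) = dot_from o x y / (a * b).
Proof.
move=> a0 b0 ox oy; rewrite /law_cos.
have -> : a ^+ 2 + b ^+ 2 - edist x y ^+ 2 = 2 * dot_from o x y.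
  by rewrite -ox -oy !edist_sqr /dot_from; ring.
by field; rewrite !gt_eqF.
Qed.

Lemma apex_cos_relation (R : realType) (o w1 w2 w3 w4 : 'rV[R]_3)
    (a1 a2 a3 a4 l1 l2 l3 l4 : R) :
  0 < a1 -> 0 < a2 -> 0 < a3 -> 0 < a4 ->
  edist o w1 = a1 -> edist o w2 = a2 -> edist o w3 = a3 -> edist o w4 = a4 ->
  edist w1 w2 = l1 -> edist w2 w3 = l2 -> edist w3 w4 = l3 -> edist w4 w1 = l4 ->
  cos_relation (law_cos a1 a2 l1) (law_cos a2 a3 l2) (law_cos a3 a4 l3)
    (law_cos a4 a1 l4) (law_cos a1 a3 (edist w1 w3)) (law_cos a2 a4 (edist w2 w4))
  = 0.
Proof.
move=> a1p a2p a3p a4p o1 o2 o3 o4 <- <- <- <-.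
rewrite (law_cos_edist a1p a2p o1 o2) (law_cos_edist a2p a3p o2 o3).
rewrite (law_cos_edist a3p a4p o3 o4) (law_cos_edist a4p a1p o4 o1).
rewrite (law_cos_edist a1p a3p o1 o3) (law_cos_edist a2p a4p o2 o4).
pose d (z : 'rV[R]_3) i := z 0 i - o 0 i.
pose i : 'I_3 := ord0; pose j : 'I_3 := lift ord0 ord0.
pose k : 'I_3 := lift ord0 (lift ord0 ord0).
have := gram_det4_eq0 (d w1 i) (d w1 j) (d w1 k) (d w2 i) (d w2 j) (d w2 k)
  (d w3 i) (d w3 j) (d w3 k) (d w4 i) (d w4 j) (d w4 k).
cbv zeta; rewrite -/(dot_from o w1 w1) -/(dot_from o w2 w2) -/(dot_from o w3 w3)
  -/(dot_from o w4 w4) !dot_fromxx o1 o2 o3 o4.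
rewrite -/(dot_from o w1 w2) -/(dot_from o w2 w3) -/(dot_from o w3 w4)
  -/(dot_from o w4 w1) -/(dot_from o w1 w3) -/(dot_from o w2 w4) /cos_relation.
set F := (F in F = 0) => F0.
transitivity (F / (a1 * a2 * a3 * a4) ^+ 2); last by rewrite F0 mul0r.
by rewrite /F; field; rewrite !gt_eqF.
Qed.

Lemma law_cos_sqr_lt1 (R : realFieldType) (a b c : R) :
  0 < a -> 0 < b -> a < b + c -> b < c + a -> c < a + b ->
  law_cos a b c ^+ 2 < 1.
Proof.
move=> a0 b0 abc bca cab; rewrite /law_cos expr_div_n.
rewrite ltr_pdivrMr ?exprn_gt0 ?mulr_gt0// mul1r -subr_gt0.
(* Heron's product, 16 times the squared area. *)
have -> : (2 * a * b) ^+ 2 - (a ^+ 2 + b ^+ 2 - c ^+ 2) ^+ 2 =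
  (b + c - a) * (c + a - b) * ((a + b - c) * (a + b + c)) by ring.
by rewrite !mulr_gt0 ?subr_gt0 ?addr_gt0//; lra.
Qed.

(** * Combinatorics of the octahedron *)

Lemma oppositeK : involutive opposite.
Proof. by case. Qed.

Lemma edge_sym a b : edge a b -> edge b a.
Proof.
by case=> ab ba; split=> [/esym//|aE]; apply: ba; rewrite aE oppositeK.
Qed.

Lemma edge_opposite a b : edge a b -> edge a (opposite b).
Proof.
case=> ab ba; split=> [aE|/(can_inj oppositeK)/esym//].
by apply: ba; rewrite aE oppositeK.
Qed.

Lemma strict_triangle (R : realType) (l : vertex -> vertex -> R) a b c :
  metric_octahedron l -> edge a b -> edge b c -> edge c a ->
  l a b < l b c + l c a.
Proof.
case=> lC _ lface ab bc ca.
(* Three pairwise adjacent vertices span a face, which [face] lists in just one of the six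
   orders. *)
have : [|| face a b c, face b c a, face c a b, face a c b, face c b a | face b a c].
  by move: ab bc ca => {lC lface}[ab ab'] [bc bc'] [ca ca'];
    case: a ab ab' ca ca'; case: b bc bc' => //; case: c.
have [[lab lbc] lca] := (lC _ _ ab, lC _ _ bc, lC _ _ ca).
by do 5?[case/orP]; move=> /lface[]; lra.
Qed.

(** * Values of a diagonal along a flex *)

Lemma coord_within_continuous (R : realType) (A : set R) (p : R -> 'rV[R]_3) i :
  {within A, continuous p} -> {within A, continuous (fun t => p t 0 i)}.
Proof.
move=> pc x; apply: (@cvg_comp _ _ _ p (fun u : 'rV[R]_3 => u 0 i));
  [exact: pc | exact: coord_continuous].
Qed.

Lemma edist_sqr_within_continuous (R : realType) (A : set R)
    (p q : R -> 'rV[R]_3) :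
  {within A, continuous p} -> {within A, continuous q} ->
  {within A, continuous (fun t => edist (p t) (q t) ^+ 2)}.
Proof.
move=> pc qc.
have -> : (fun t => edist (p t) (q t) ^+ 2) = fun t =>
    (p t 0 ord0 - q t 0 ord0) ^+ 2 +
    ((p t 0 (lift ord0 ord0) - q t 0 (lift ord0 ord0)) ^+ 2 +
     (p t 0 (lift ord0 (lift ord0 ord0)) - q t 0 (lift ord0 (lift ord0 ord0))) ^+ 2).
  by apply: funext => t; rewrite edist_sqr.
have sqc i : {within A, continuous (fun t => (p t 0 i - q t 0 i) ^+ 2)}.
  move=> x; have dc : {for x, continuous (fun t : subspace A => p t 0 i - q t 0 i)}.
    by apply: cvgB; exact: coord_within_continuous.
  by under eq_fun do rewrite expr2; apply: cvgM.
by move=> x; apply: cvgD; [exact: sqc | apply: cvgD; exact: sqc].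
Qed.

(** A diagonal takes two distinct values on a segment of the flex, hence all values between them. *)
Lemma flex_diagonal_itv (R : realType) (l : vertex -> vertex -> R)
    (I : set R) (P : R -> vertex -> 'rV[R]_3) (v : vertex) :
  nontrivial_flex l I P ->
  exists a b : R, a < b /\ forall y, a < y < b ->
    exists2 t, I t & edist (P t v) (P t (opposite v)) ^+ 2 = y.
Proof.
move=> [[Iitv [s [t [Is It st]]]] Pc _ nonconst].
pose f x := edist (P x v) (P x (opposite v)) ^+ 2.
have subI : `[s, t] `<=` I.
  by move=> x /=; rewrite in_itv /= => xst; exact: Iitv Is It _ xst.
have [u [su ut fsu]] : exists u, [/\ s <= u, u <= t & f s != f u].
  apply: contrapT => H; apply: (nonconst v _ _ subI _).
    split; first exact: interval_is_interval.
    by exists s, t; rewrite /= !in_itv /= !lexx ltW.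
  exists (edist (P s v) (P s (opposite v))) => u /=; rewrite in_itv => /andP[su ut].
  apply: contrapT => dsu; apply: H; exists u; split=> //.
  by apply: contra_notN dsu; rewrite eqrXn2 ?sqrtr_ge0// => /eqP ->.
exists (Num.min (f s) (f u)), (Num.max (f s) (f u)); split.
  by rewrite gt_min !lt_max !ltxx orbF /= -neq_lt.
move=> y /andP[/ltW fy /ltW yf].
have fc : {within `[s, u], continuous f}.
  apply: edist_sqr_within_continuous; apply: continuous_subspaceW (Pc _);
  by apply: subset_trans subI; apply: subset_itvl; rewrite bnd_simp.
have [|x xsu fx] := IVT su fc (v := y); first by rewrite fy.
exists x => //; apply: subI; move: xsu; rewrite /= !in_itv /= => /andP[-> xu].
exact: le_trans ut.
Qed.

(** * From class I to metric symmetry *)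

(* [opp] is [pi - x] on angles and [- x] on their cosines. *)
Definition class_I_quad (T : Type) (opp : T -> T) (x1 x2 x3 x4 : T) :=
  [/\ ~ ((x1 = x3 /\ x2 = x4) \/ (x1 = opp x3 /\ x2 = opp x4)),
      ~ ((x1 = x4 /\ x2 = x3) \/ (x1 = opp x4 /\ x2 = opp x3))
    & ~ ((x1 = x2 /\ x3 = x4) \/ (x1 = opp x2 /\ x3 = opp x4))].

(** Rotation preserves the class III condition and swaps the two class II conditions, so each
    diagonal of the equator can play the role of [y]. *)
Lemma class_I_quad_rot (T : Type) (opp : T -> T) (x1 x2 x3 x4 : T) :
  involutive opp ->
  class_I_quad opp x1 x2 x3 x4 -> class_I_quad opp x2 x3 x4 x1.
Proof.
move=> oppK [N3 N13 N24].
split=> -[] [e e']; [apply: N3 | apply: N3 | apply: N24 | apply: N24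
  | apply: N13 | apply: N13]; subst; rewrite ?oppK; by [left | right].
Qed.

(** [plane_angle l v a b] is convertible to [acos (star_cos l v a b)]. *)
Definition star_cos (R : realType) (l : vertex -> vertex -> R) (v a b : vertex) :=
  law_cos (l v a) (l v b) (l a b).

Lemma star_cos_sqr_lt1 (R : realType) (l : vertex -> vertex -> R) v a b :
  metric_octahedron l -> edge v a -> edge v b -> edge a b ->
  star_cos l v a b ^+ 2 < 1.
Proof.
move=> ml va vb ab; have [lC lpos _] := ml.
have [[av bv] ba] := (edge_sym va, edge_sym vb, edge_sym ab).
have := strict_triangle ml va ab bv; have := strict_triangle ml vb ba av.
have := strict_triangle ml ab bv va.
rewrite (lC _ _ av) (lC _ _ bv) (lC _ _ ba) => ? ? ?.
by apply: law_cos_sqr_lt1; rewrite ?lpos//; lra.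
Qed.

Definition star_cos_class_I (R : realType) (l : vertex -> vertex -> R)
    (v w1 w2 : vertex) :=
  class_I_quad (@GRing.opp R) (star_cos l v w1 w2) (star_cos l v w2 (opposite w1))
    (star_cos l v (opposite w1) (opposite w2)) (star_cos l v (opposite w2) w1).

Lemma opposite_spokes_eq (R : realType) (l : vertex -> vertex -> R)
    (v w1 w2 : vertex) :
  metric_octahedron l -> nontrivially_flexible l ->
  edge v w1 -> edge v w2 -> edge w1 w2 -> star_cos_class_I l v w1 w2 ->
  (l v w1 = l (opposite v) w1 /\ l v (opposite w1) = l (opposite v) (opposite w1)) \/
  (l v w1 = l (opposite v) (opposite w1) /\ l v (opposite w1) = l (opposite v) w1).
Proof.
move=> ml [I [P flex]] vw1 vw2 w12 [N3 N13 N24].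
have [lC lpos _] := ml.
have [a [b [ab diag]]] := flex_diagonal_itv w1 flex.
have [_ _ real _] := flex.
have eo x y : edge x y -> edge (opposite x) y.
  by move=> xy; apply/edge_sym/edge_opposite/edge_sym.
have [vw3 vw4] := (edge_opposite vw1, edge_opposite vw2).
have w23 := edge_opposite (edge_sym w12).
have w34 := eo _ _ (edge_opposite w12).
have w41 := eo _ _ (edge_sym w12).
have [ow1 ow2 ow3 ow4] := And4 (eo _ _ vw1) (eo _ _ vw2) (eo _ _ vw3) (eo _ _ vw4).
apply: pair_eq_of_diagonal_roots; rewrite ?lpos//.
have two_mul_gt0 (x y : R) : 0 < x -> 0 < y -> 0 < 2 * x * y.
  by move=> ? ?; rewrite !mulr_gt0.
(* The chosen [t, k, t', k'] turn [(t - z) / k] and [(t' - z) / k'] into the law of cosines for the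
   second diagonal; [s, h, s', h'] come from the goal. *)
apply: (common_relation_roots
  (c1' := star_cos l (opposite v) w1 w2)
  (c2' := star_cos l (opposite v) w2 (opposite w1))
  (c3' := star_cos l (opposite v) (opposite w1) (opposite w2))
  (c4' := star_cos l (opposite v) (opposite w2) w1)
  (t := l v w2 ^+ 2 + l v (opposite w2) ^+ 2)
  (k := 2 * l v w2 * l v (opposite w2))
  (t' := l (opposite v) w2 ^+ 2 + l (opposite v) (opposite w2) ^+ 2)
  (k' := 2 * l (opposite v) w2 * l (opposite v) (opposite w2))
  _ _ _ _ _ _ _ _ N3 N13 N24 ab);
  rewrite ?two_mul_gt0 ?lpos ?star_cos_sqr_lt1//.
move=> y /diag[t /real re <-]; exists (edist (P t w2) (P t (opposite w2)) ^+ 2).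
have {}re x z : edge x z -> edist (P t x) (P t z) = l x z by exact: re.
by split; [apply: (apex_cos_relation (o := P t v))
  | apply: (apex_cos_relation (o := P t (opposite v)))]; rewrite ?lpos ?re.
Qed.

Lemma star_cos_class_I_rot (R : realType) (l : vertex -> vertex -> R) v w1 w2 :
  star_cos_class_I l v w1 w2 -> star_cos_class_I l v w2 (opposite w1).
Proof. by rewrite /star_cos_class_I oppositeK; apply/class_I_quad_rot/opprK. Qed.

Lemma class_I_quad_acos (R : realType) (c1 c2 c3 c4 : R) :
  c2 ^+ 2 < 1 -> c3 ^+ 2 < 1 -> c4 ^+ 2 < 1 ->
  class_I_quad (fun x => pi - x) (acos c1) (acos c2) (acos c3) (acos c4) ->
  class_I_quad -%R c1 c2 c3 c4.
Proof.
have bnd (c : R) : c ^+ 2 < 1 -> -1 <= c <= 1.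
  by move=> cl; apply/andP; split; nra.
move=> /bnd c2l /bnd c3l /bnd c4l [N3 N13 N24].
split=> -[[e e']|[e e']];
  [apply: N3 | apply: N3 | apply: N13 | apply: N13 | apply: N24 | apply: N24];
  rewrite e e'; try (by left); by right; rewrite !acosN.
Qed.

(** Class II includes the negation of class III, so excluding III and both II excludes the bare
    angle equalities. *)
Lemma star_class_I_quad (R : realType) (l : vertex -> vertex -> R) v :
  star_class_I l v ->
  let: (w1, w2, w3, w4) := equator_cycle (star_boundary v) in
  class_I_quad (fun x => pi - x) (plane_angle l v w1 w2) (plane_angle l v w2 w3)
    (plane_angle l v w3 w4) (plane_angle l v w4 w1).
Proof.
rewrite /star_class_I /star_class_II13 /star_class_II24 /star_class_III /star_angles.
case: (equator_cycle _) => [[[w1 w2] w3] w4] [N3 N13 N24].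
by split=> // H; [apply: N13 | apply: N24].
Qed.

Lemma star_class_I_opposite_spokes (R : realType) (l : vertex -> vertex -> R)
    (v w1 w2 : vertex) :
  metric_octahedron l -> nontrivially_flexible l -> star_class_I l v ->
  equator_cycle (star_boundary v) = (w1, w2, opposite w1, opposite w2) ->
  edge v w1 -> edge v w2 -> edge w1 w2 ->
  ((l v w1 = l (opposite v) w1 /\ l v (opposite w1) = l (opposite v) (opposite w1)) \/
   (l v w1 = l (opposite v) (opposite w1) /\ l v (opposite w1) = l (opposite v) w1)) /\
  ((l v w2 = l (opposite v) w2 /\ l v (opposite w2) = l (opposite v) (opposite w2)) \/
   (l v w2 = l (opposite v) (opposite w2) /\ l v (opposite w2) = l (opposite v) w2)).
Proof.
move=> ml fl /star_class_I_quad + cyc vw1 vw2 w12; rewrite cyc => quad.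
have [vw3 vw4] := (edge_opposite vw1, edge_opposite vw2).
have w23 := edge_opposite (edge_sym w12).
have w34 := edge_opposite (edge_sym w23).
have w41 := edge_sym (edge_opposite w12).
have cI : star_cos_class_I l v w1 w2.
  by apply: class_I_quad_acos quad; apply: star_cos_sqr_lt1 => //; exact: edge_sym.
split; first exact: opposite_spokes_eq cI.
exact: (opposite_spokes_eq ml fl vw2 vw3 w23 (star_cos_class_I_rot cI)).
Qed.

(** The sides of [e'] join the two apices over [e] to two opposite vertices of [e]. The two pairings
    of these spokes give the alternatives of metric symmetry, the choice depending on where the
    cycle of [e'] starts. *)
Lemma metrically_symmetric_of_class_I (R : realType) (l : vertex -> vertex -> R)
    (e e' : equator) :
  metric_octahedron l -> nontrivially_flexible l ->
  equator_class_I l e -> e' <> e -> metrically_symmetric l e'.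
Proof.
move=> ml fl cI; have [lC _ _] := ml.
have E (v w1 w2 : vertex) := @star_class_I_opposite_spokes R l v w1 w2 ml fl.
rewrite /metrically_symmetric.
have [c21 c41] := (lC v2 v1 ltac:(by []), lC v4 v1 ltac:(by [])).
have [c26 c46] := (lC v2 v6 ltac:(by []), lC v4 v6 ltac:(by [])).
have [c51 c31] := (lC v5 v1 ltac:(by []), lC v3 v1 ltac:(by [])).
have [c56 c36] := (lC v5 v6 ltac:(by []), lC v3 v6 ltac:(by [])).
have [c23 c34] := (lC v2 v3 ltac:(by []), lC v3 v4 ltac:(by [])).
have [c45 c52] := (lC v4 v5 ltac:(by []), lC v5 v2 ltac:(by [])).
case: e cI => cI; [have [//|//|//|] := E v1 v2 v3 (cI v1 erefl) erefl
  | have [//|//|//|] := E v3 v2 v1 (cI v3 erefl) erefl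
  | have [//|//|//|] := E v2 v5 v1 (cI v2 erefl) erefl];
  move=> /= [] [e1 e2] [] [e3 e4]; case: e' => //= _;
  try (apply: Or31; split; congruence);
  try (apply: Or32; split; congruence);
  apply: Or33; split; congruence.
Qed.

Theorem mainTheorem2 (R : realType) (l : vertex -> vertex -> R)
    (hmetric : metric_octahedron l)
    (hflex : nontrivially_flexible l)
    (hI : exists e1 e2 : equator,
        [/\ e1 <> e2, equator_class_I l e1 & equator_class_I l e2]) :
  forall e : equator, metrically_symmetric l e.
Proof.
move=> e; have [e1 [e2 [e12 cI1 cI2]]] := hI.
have [ee1|ee1] := pselect (e = e1).
  by apply: metrically_symmetric_of_class_I cI2 _ => //; rewrite ee1.
exact: metrically_symmetric_of_class_I cI1 _.
Qed.
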